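(* Let $\beta=(\beta_{ij})_{i,j\ge 0,\ i+j\le 6}$ be a real sequence such that $\mathcal M(3)(\beta)$ is positive semidefinite, $\mathcal M(2)(\beta)$ is positive definite, and $\operatorname{rank}\mathcal M(3)=\operatorname{card}\mathcal V=7$, where $\mathcal V$ is the algebraic variety of $\mathcal M(3)$. Suppose the columns $\mathcal B_3=\{1,X,Y,X^2,XY,Y^2,XY^2\}$ form a basis of the column space of $\mathcal M(3)$. Then $\beta$ admits a representing measure if and only if $\mathcal M(3)$ is weakly consistent.
   Context: The moment matrix $\mathcal M(3)(\beta)$ has rows and columns indexed by $1,X,Y,X^2,XY,Y^2,X^3,X^2Y,XY^2,Y^3$ in this order, with entry $\beta_{i+k,j+l}$ in row $X^iY^j$ and column $X^kY^l$; $\mathcal M(2)(\beta)$ is its principal submatrix indexed by monomials of degree $\le 2$. For $p(x,y)=\sum a_{ij}x^iy^j$ of degree $\le 3$, $p(X,Y)=\sum a_{ij}X^iY^j$ is the corresponding linear combination of columns. The algebraic variety is $\mathcal V=\bigcap\{\mathcal Z(p):\deg p\le 3,\ p(X,Y)=\mathbf 0\}$ with $\mathcal Z(p)$ the real zero set of $p$. A representing measure is a positive Borel measure $\mu$ on $\mathbb R^2$ with $\beta_{ij}=\int x^iy^j\,d\mu$ for $i+j\le 6$. $\mathcal M(3)$ is weakly consistent if every polynomial $p$ of degree $\le 3$ vanishing on $\mathcal V$ satisfies $p(X,Y)=\mathbf 0$. *)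

(* Defs.v *)
From HB Require Import structures.
From mathcomp Require Import all_boot all_order all_algebra.
From mathcomp Require Import all_classical all_reals all_analysis.
Set Implicit Arguments. Unset Strict Implicit. Unset Printing Implicit Defensive.
Import Order.TTheory GRing.Theory Num.Theory.
Local Open Scope ring_scope.
Local Open Scope classical_set_scope.

(* Monomials of degree <= 3, in the order 1,X,Y,X^2,XY,Y^2,X^3,X^2Y,XY^2,Y^3;
   the k-th monomial is x^(mon k).1 y^(mon k).2. *)
Definition monlist : seq (nat * nat) :=
  [:: (0,0); (1,0); (0,1); (2,0); (1,1); (0,2); (3,0); (2,1); (1,2); (0,3)]%N.
Definition mon (k : nat) : nat * nat := nth (0,0)%N monlist k.

Definition M3 (R : ringType) (beta : nat -> nat -> R) : 'M[R]_10 :=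
  \matrix_(r < 10, c < 10) beta ((mon r).1 + (mon c).1)%N ((mon r).2 + (mon c).2)%N.

Definition M2 (R : ringType) (beta : nat -> nat -> R) : 'M[R]_6 :=
  \matrix_(r < 6, c < 6) beta ((mon r).1 + (mon c).1)%N ((mon r).2 + (mon c).2)%N.

Definition psd (R : numDomainType) n (A : 'M[R]_n) : Prop :=
  A^T = A /\ forall v : 'cV[R]_n, 0 <= (v^T *m A *m v) 0 0.
Definition pd (R : numDomainType) n (A : 'M[R]_n) : Prop :=
  A^T = A /\ forall v : 'cV[R]_n, v != 0 -> 0 < (v^T *m A *m v) 0 0.

(* A polynomial of degree <= 3 is given by its coefficient vector a (coefficient
   of the k-th monomial in row k); p(X,Y) is M3 *m a; evaluation at a point: *)
Definition peval (R : ringType) (a : 'cV[R]_10) (z : R * R) : R :=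
  \sum_(k < 10) a k 0 * z.1 ^+ (mon k).1 * z.2 ^+ (mon k).2.

Definition variety (R : realType) (beta : nat -> nat -> R) : set (R * R) :=
  [set z | forall a : 'cV[R]_10, M3 beta *m a = 0 -> peval a z = 0].

Definition weakly_consistent (R : realType) (beta : nat -> nat -> R) : Prop :=
  forall a : 'cV[R]_10,
    (forall z, variety beta z -> peval a z = 0) -> M3 beta *m a = 0.

Definition B3idx : seq nat := [:: 0; 1; 2; 3; 4; 5; 8]%N.
Definition B3f (i : 'I_7) : 'I_10 := inord (nth 0%N B3idx i).

Definition B3_basis (R : fieldType) (beta : nat -> nat -> R) : Prop :=
  let C := colsub B3f (M3 beta) in
  row_free C^T /\ (C^T == (M3 beta)^T)%MS.

Definition has_rep_measure (R : realType) (beta : nat -> nat -> R) : Prop :=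
  exists mu : {measure set (R * R) -> \bar R},
    forall i j : nat, (i + j <= 6)%N ->
      mu.-integrable setT (fun z : R * R => (z.1 ^+ i * z.2 ^+ j)%:E) /\
      (\int[mu]_z (z.1 ^+ i * z.2 ^+ j)%:E = (beta i j)%:E)%E.

(* Main.v *)
(* The relations of M(3) are spanned by three cubics with leading forms
   x^3 - a xy^2, x^2y - b xy^2 and y^3 - c xy^2.

   A representing measure integrates the square of each relation to 0, so it is
   carried by V; hence a cubic vanishing on V is null almost everywhere and is
   itself a relation.

   Conversely, under weak consistency the cubics restrict onto all functions on
   the seven points of V, with kernel the relations.  So the Riesz functional of
   beta agrees in degree <= 3 with a combination of the evaluations at V, whose
   weights are its values at the Lagrange interpolants.  Let d be the difference
   of the two functionals; it kills every multiple of a relation by a cubic.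
   Unless b = ac and bc = 1, the leading forms generate all forms of degree 4,
   so d vanishes in degrees 4, 5 and 6 in turn; the weights are then the values of
   the Riesz functional at the squares of the interpolants, hence nonnegative.

   In the exceptional case the leading forms are multiples of y - cx.  The two
   leading syzygies lift to true syzygies by weak consistency, which forces the
   three cubics to share a linear factor; V would then contain a line. *)

Require Import Defs.
From HB Require Import structures.
From mathcomp Require Import all_boot all_order all_algebra.
From mathcomp Require Import all_classical all_reals all_analysis.
From mathcomp Require Import measurable_realfun ring lra zify.
Import Order.TTheory GRing.Theory Num.Theory.
Local Open Scope ring_scope.

(** * Cubics and quadratics in coordinates *)

Local Notation cf a k := (a (inord k) ord0).

Lemma big_ord10 (V : nmodType) (F : 'I_10 -> V) :
  \sum_(i < 10) F i =
    F (inord 0) + F (inord 1) + F (inord 2) + F (inord 3) + F (inord 4)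
    + F (inord 5) + F (inord 6) + F (inord 7) + F (inord 8) + F (inord 9).
Proof.
rewrite !big_ord_recl big_ord0 addr0 !addrA.
by do !congr (_ + _); congr F; apply/val_inj; rewrite /= inordK.
Qed.

Lemma pevalE (R : comNzRingType) (a : 'cV[R]_10) (x y : R) :
  peval a (x, y) =
    cf a 0 + cf a 1 * x + cf a 2 * y
    + cf a 3 * x ^+ 2 + cf a 4 * x * y + cf a 5 * y ^+ 2
    + cf a 6 * x ^+ 3 + cf a 7 * x ^+ 2 * y + cf a 8 * x * y ^+ 2
    + cf a 9 * y ^+ 3.
Proof. by rewrite /peval big_ord10 !inordK // /mon /=; ring. Qed.

Definition quadratic {R : comNzRingType} (n : seq R) (x y : R) : R :=
  n`_0 + n`_1 * x + n`_2 * y + n`_3 * x ^+ 2 + n`_4 * x * y + n`_5 * y ^+ 2.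

(** The ten sample points below are unisolvent for cubics, so the ten resulting linear equations
    already determine every coefficient. *)
Lemma cubic_coef_eq0 (R : realFieldType) (k0 k1 k2 k3 k4 k5 k6 k7 k8 k9 : R) :
  (forall x y, k0 + k1 * x + k2 * y + k3 * x ^+ 2 + k4 * x * y + k5 * y ^+ 2
     + k6 * x ^+ 3 + k7 * x ^+ 2 * y + k8 * x * y ^+ 2 + k9 * y ^+ 3 = 0) ->
  [/\ [/\ k0 = 0, k1 = 0 & k2 = 0], [/\ k3 = 0, k4 = 0 & k5 = 0]
    & [/\ k6 = 0, k7 = 0, k8 = 0 & k9 = 0]].
Proof.
move=> h.
have h00 := h 0 0; have h10 := h 1 0; have hm0 := h (-1) 0; have h20 := h 2 0.
have h01 := h 0 1; have h0m := h 0 (-1); have h02 := h 0 2.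
have h11 := h 1 1; have h1m := h 1 (-1); have hm1 := h (-1) 1.
have e0 : k0 = 0 by lra.
have e3 : k3 = 0 by lra.
have e5 : k5 = 0 by lra.
have e6 : k6 = 0 by lra.
have e1 : k1 = 0 by lra.
have e9 : k9 = 0 by lra.
have e2 : k2 = 0 by lra.
by do !split; lra.
Qed.

(** * Linear syzygies and a common linear factor *)

(* Comparing coefficients degree by degree, from the top. *)
Lemma quadratic_syzygy_eq0 (R : realFieldType) (a b c1 c2 c3 d1 d2 d3 : R)
    (p q r : seq R) :
  b != 0 -> r`_5 = 0 ->
  (forall x y, (y - c1) * quadratic p x y - (x + c2) * quadratic q x y
     + (a * x - c3) * quadratic r x y = 0) ->
  (forall x y, - d1 * quadratic p x y + (y - d2) * quadratic q x y
     + (b * x - d3) * quadratic r x y = 0) ->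
  forall x y, [/\ quadratic p x y = 0, quadratic q x y = 0
                & quadratic r x y = 0].
Proof.
rewrite /quadratic => b0 r5.
move: p`_0 p`_1 p`_2 p`_3 p`_4 p`_5 q`_0 q`_1 q`_2 q`_3 q`_4 q`_5
  r`_0 r`_1 r`_2 r`_3 r`_4 r`_5 r5 => p0 p1 p2 p3 p4 p5
  q0 q1 q2 q3 q4 q5 r0 r1 r2 r3 r4 r5 -> {r5} s1 s2.
(* The vanishing of [r5] excludes multiples of the minors of the two syzygies: the third minor has
   leading form y^2. *)
have /cubic_coef_eq0[_ _ [A6 A7 A8 A9]] :
    forall x y,
     (- c1 * p0 - c2 * q0 - c3 * r0)
     + (- c1 * p1 - c2 * q1 - q0 + a * r0 - c3 * r1) * x
     + (p0 - c1 * p2 - c2 * q2 - c3 * r2) * y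
     + (- c1 * p3 - q1 - c2 * q3 + a * r1 - c3 * r3) * x ^+ 2
     + (p1 - c1 * p4 - q2 - c2 * q4 + a * r2 - c3 * r4) * x * y
     + (p2 - c1 * p5 - c2 * q5) * y ^+ 2
     + (- q3 + a * r3) * x ^+ 3 + (p3 - q4 + a * r4) * x ^+ 2 * y
     + (p4 - q5) * x * y ^+ 2 + p5 * y ^+ 3 = 0.
  by move=> x y; rewrite -[RHS](s1 x y); ring.
have /cubic_coef_eq0[_ _ [B6 B7 B8 B9]] :
    forall x y,
     (- d1 * p0 - d2 * q0 - d3 * r0)
     + (- d1 * p1 - d2 * q1 + b * r0 - d3 * r1) * x
     + (- d1 * p2 + q0 - d2 * q2 - d3 * r2) * y
     + (- d1 * p3 - d2 * q3 + b * r1 - d3 * r3) * x ^+ 2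
     + (- d1 * p4 + q1 - d2 * q4 + b * r2 - d3 * r4) * x * y
     + (- d1 * p5 + q2 - d2 * q5) * y ^+ 2
     + (b * r3) * x ^+ 3 + (q3 + b * r4) * x ^+ 2 * y
     + q4 * x * y ^+ 2 + q5 * y ^+ 3 = 0.
  by move=> x y; rewrite -[RHS](s2 x y); ring.
have bI t : b * t = 0 -> t = 0 by move/eqP; rewrite mulf_eq0 (negPf b0) => /eqP.
have {B6}r3z := bI _ B6.
rewrite r3z mulr0 addr0 in A6; move/eqP: A6; rewrite oppr_eq0 => /eqP q3z.
rewrite q3z add0r in B7; have {B7}r4z := bI _ B7.
have p3z : p3 = 0 by move: A7; rewrite B8 r4z mulr0 subr0 addr0.
have p4z : p4 = 0 by move: A8; rewrite B9 subr0.
subst p3 p4 p5 q3 q4 q5 r3 r4.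
have /cubic_coef_eq0[_ [A3 A4 A5] _] :
    forall x y,
     (- c1 * p0 - c2 * q0 - c3 * r0)
     + (- c1 * p1 - c2 * q1 - q0 + a * r0 - c3 * r1) * x
     + (p0 - c1 * p2 - c2 * q2 - c3 * r2) * y
     + (- q1 + a * r1) * x ^+ 2 + (p1 - q2 + a * r2) * x * y
     + p2 * y ^+ 2
     + 0 * x ^+ 3 + 0 * x ^+ 2 * y + 0 * x * y ^+ 2 + 0 * y ^+ 3 = 0.
  by move=> x y; rewrite -[RHS](s1 x y); ring.
have /cubic_coef_eq0[_ [B3 B4 B5] _] :
    forall x y,
     (- d1 * p0 - d2 * q0 - d3 * r0)
     + (- d1 * p1 - d2 * q1 + b * r0 - d3 * r1) * x
     + (- d1 * p2 + q0 - d2 * q2 - d3 * r2) * y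
     + (b * r1) * x ^+ 2 + (q1 + b * r2) * x * y
     + q2 * y ^+ 2
     + 0 * x ^+ 3 + 0 * x ^+ 2 * y + 0 * x * y ^+ 2 + 0 * y ^+ 3 = 0.
  by move=> x y; rewrite -[RHS](s2 x y); ring.
have r1z := bI _ B3.
rewrite r1z mulr0 addr0 in A3; move/eqP: A3; rewrite oppr_eq0 => /eqP q1z.
rewrite q1z add0r in B4; have r2z := bI _ B4.
have p1z : p1 = 0 by move: A4; rewrite B5 r2z mulr0 subr0 addr0.
subst p1 p2 q1 q2 r1 r2.
have /cubic_coef_eq0[[_ A1 A2] _ _] :
    forall x y,
     (- c1 * p0 - c2 * q0 - c3 * r0) + (- q0 + a * r0) * x + p0 * y
     + 0 * x ^+ 2 + 0 * x * y + 0 * y ^+ 2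
     + 0 * x ^+ 3 + 0 * x ^+ 2 * y + 0 * x * y ^+ 2 + 0 * y ^+ 3 = 0.
  by move=> x y; rewrite -[RHS](s1 x y); ring.
have /cubic_coef_eq0[[_ B1 B2] _ _] :
    forall x y,
     (- d1 * p0 - d2 * q0 - d3 * r0) + (b * r0) * x + q0 * y
     + 0 * x ^+ 2 + 0 * x * y + 0 * y ^+ 2
     + 0 * x ^+ 3 + 0 * x ^+ 2 * y + 0 * x * y ^+ 2 + 0 * y ^+ 3 = 0.
  by move=> x y; rewrite -[RHS](s2 x y); ring.
have r0z := bI _ B1.
by subst => x y; split; ring.
Qed.

(* By Hilbert-Burch the cubics [f_i] are proportional to the minors [m_i] of
   their two linear syzygies; comparing degrees, the ratio is a linear form. *)
Lemma common_line (R : realFieldType) (f1 f2 f3 : 'cV[R]_10)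
    (a b c c1 c2 c3 d1 d2 d3 : R) :
  b = a * c -> b * c = 1 ->
  [/\ cf f1 6 = 1, cf f1 7 = 0, cf f1 8 = - a & cf f1 9 = 0] ->
  [/\ cf f2 6 = 0, cf f2 7 = 1, cf f2 8 = - b & cf f2 9 = 0] ->
  [/\ cf f3 6 = 0, cf f3 7 = 0, cf f3 8 = - c & cf f3 9 = 1] ->
  (forall x y, (y - c1) * peval f1 (x, y) - (x + c2) * peval f2 (x, y)
     + (a * x - c3) * peval f3 (x, y) = 0) ->
  (forall x y, - d1 * peval f1 (x, y) + (y - d2) * peval f2 (x, y)
     + (b * x - d3) * peval f3 (x, y) = 0) ->
  exists k, forall x, [/\ peval f1 (x, c * x + k) = 0,
    peval f2 (x, c * x + k) = 0 & peval f3 (x, c * x + k) = 0].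
Proof.
move=> bac bc1 [f16 f17 f18 f19] [f26 f27 f28 f29] [f36 f37 f38 f39] s1 s2.
(* This [k] makes the y^2 coefficient of f3 - (y - c x - k) m3 vanish. *)
pose k := - cf f3 5 - c1 - d2.
(* Signed 2x2 minors of the two syzygies, as coefficients of 1, x, y, x^2, xy, y^2. *)
pose m1 := [:: c2 * d3 - c3 * d2; d3 - b * c2 + a * d2; c3; - b; - a; 0].
pose m2 := [:: c3 * d1 - c1 * d3; b * c1 - a * d1; d3; 0; - b; 0].
pose m3 := [:: c1 * d2 - c2 * d1; - d1; - (c1 + d2); 0; 0; 1].
(* Coefficients of f - (y - c x - k) m, which is quadratic once the cubic parts cancel; b = ac and
   bc = 1 ensure this for the three pairs. *)
pose h (f : 'cV[R]_10) (m : seq R) : seq R :=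
  [:: cf f 0 + k * m`_0; cf f 1 + c * m`_0 + k * m`_1;
      cf f 2 - m`_0 + k * m`_2; cf f 3 + c * m`_1 + k * m`_3;
      cf f 4 - m`_1 + c * m`_2 + k * m`_4; cf f 5 - m`_2 + k * m`_5].
have hE (f : 'cV[R]_10) (m : seq R) x y : cf f 6 = - c * m`_3 ->
    cf f 7 = m`_3 - c * m`_4 ->
    cf f 8 = m`_4 - c * m`_5 -> cf f 9 = m`_5 ->
    quadratic (h f m) x y =
    peval f (x, y) - (y - c * x - k) * quadratic m x y.
  by move=> e6 e7 e8 e9; rewrite pevalE /quadratic /h /= e6 e7 e8 e9; ring.
have b0 : b != 0.
  by apply: contra_eq_neq bc1 => ->; rewrite mul0r eq_sym oner_eq0.
have h1 x y : quadratic (h f1 m1) x y =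
    peval f1 (x, y) - (y - c * x - k) * quadratic m1 x y.
  apply: hE; rewrite /m1 /= ?f16 ?f17 ?f18 ?f19 -?bc1 ?bac; ring.
have h2 x y : quadratic (h f2 m2) x y =
    peval f2 (x, y) - (y - c * x - k) * quadratic m2 x y.
  apply: hE; rewrite /m2 /= ?f26 ?f27 ?f28 ?f29 -?bc1 ?bac; ring.
have h3 x y : quadratic (h f3 m3) x y =
    peval f3 (x, y) - (y - c * x - k) * quadratic m3 x y.
  apply: hE; rewrite /m3 /= ?f36 ?f37 ?f38 ?f39; ring.
(* The minors satisfy both syzygies identically, so the three differences inherit them and must
   vanish. *)
have H : forall x y, [/\ quadratic (h f1 m1) x y = 0,
    quadratic (h f2 m2) x y = 0 & quadratic (h f3 m3) x y = 0].
  apply: (@quadratic_syzygy_eq0 _ a b c1 c2 c3 d1 d2 d3) => //.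
  - by rewrite /h /m3 /k /=; ring.
  - move=> x y; rewrite h1 h2 h3.
    rewrite -[RHS](s1 x y) /quadratic /m1 /m2 /m3 /=; ring.
  - move=> x y; rewrite h1 h2 h3.
    rewrite -[RHS](s2 x y) /quadratic /m1 /m2 /m3 /=; ring.
exists k => x.
have [] := H x (c * x + k); rewrite h1 h2 h3.
have -> : c * x + k - c * x - k = 0 by ring.
by rewrite !mul0r !subr0.
Qed.

(** * Atomic measures, and integration of cubics *)

(** A finite sum of scaled Dirac masses. The integral formula is obtained first for nonnegative
    functions, then by splitting into positive and negative parts. *)
Lemma atomic_measure (R : realType) (d : measure_display)
    (T : measurableType d) (n : nat) (w : nat -> R) (z : nat -> T) :
  (forall i, 0 <= w i) ->
  exists mu : {measure set T -> \bar R}, forall f : T -> R,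
    measurable_fun setT f ->
    mu.-integrable setT (EFin \o f) /\
    (\int[mu]_x (f x)%:E = (\sum_(i < n) w i * f (z i))%:E)%E.
Proof.
move=> w0.
pose m_ i : {measure set T -> \bar R} :=
  mscale (NngNum (w0 i)) (dirac (z i)).
pose mu : {measure set T -> \bar R} := msum m_ n.
have ge0E (g : T -> R) : measurable_fun setT g -> (forall x, 0 <= g x) ->
    (\int[mu]_x (g x)%:E = (\sum_(i < n) w i * g (z i))%:E)%E.
  move=> mg g0.
  have mg' := (measurable_EFinP setT g).2 mg.
  have g0' x : setT x -> (0 <= (EFin \o g) x)%E by rewrite lee_fin.
  rewrite (ge0_integral_measure_sum _ measurableT g0' mg') -sumEFin.
  apply: eq_bigr => i _.
  rewrite (ge0_integral_mscale _ measurableT _ mg' g0').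
  by rewrite (integral_dirac _ measurableT mg') diracT mul1e.
exists mu => f mf; split.
  apply/integrableP; split; first exact/measurable_EFinP.
  have mn : measurable_fun setT (fun x => `|f x|) by exact: measurableT_comp.
  have e : (\int[mu]_x `|(f x)%:E| = _)%E := ge0E _ mn (fun x => normr_ge0 (f x)).
  by rewrite e ltry.
rewrite integralE.
have -> : (fun x => (f x)%:E)^\+%E = (fun x => (Num.max (f x) 0)%:E).
  by apply/funext => x; rewrite funeposE -EFin_max.
have -> : (fun x => (f x)%:E)^\-%E = (fun x => (Num.max (- f x) 0)%:E).
  by apply/funext => x; rewrite funenegE -EFin_max.
rewrite !ge0E; first last.
- by move=> x; rewrite le_max lexx orbT.
- exact: measurable_maxr.
- by move=> x; rewrite le_max lexx orbT.
- by apply: measurable_maxr => //; exact: measurableT_comp.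
rewrite -EFinB -sumrB; congr (_%:E); apply: eq_bigr => i _.
rewrite -mulrBr; congr (_ * _).
by rewrite /Num.max; case: ifPn; case: ifPn; lra.
Qed.

Lemma measurable_monomial (R : realType) i j :
  measurable_fun setT (fun z : R * R => z.1 ^+ i * z.2 ^+ j).
Proof.
by apply: measurable_funM; apply: measurable_funX.
Qed.

Lemma measurable_peval (R : realType) (a : 'cV[R]_10) :
  measurable_fun setT (peval a).
Proof.
apply: measurable_sum => k.
under eq_fun do rewrite -mulrA.
by apply: measurable_funM => //; exact: measurable_monomial.
Qed.

Lemma mon_deg (k : 'I_10) : ((mon k).1 + (mon k).2 <= 3)%N.
Proof. by case: k; do 10?[case => //]. Qed.

(** The condition inside [has_rep_measure], isolated for a fixed measure. *)
Definition represents (R : realType) (mu : {measure set (R * R) -> \bar R})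
    (beta : nat -> nat -> R) : Prop :=
  forall i j : nat, (i + j <= 6)%N ->
    mu.-integrable setT (fun z : R * R => (z.1 ^+ i * z.2 ^+ j)%:E) /\
    (\int[mu]_z (z.1 ^+ i * z.2 ^+ j)%:E = (beta i j)%:E)%E.

(** Expanding [peval a] leaves only moments of degree at most 3 + 3, which [beta] prescribes. *)
Lemma integral_peval_mon (R : realType) (beta : nat -> nat -> R)
    (mu : {measure set (R * R) -> \bar R}) (a : 'cV[R]_10) (r : 'I_10) :
  represents R mu beta ->
  mu.-integrable setT
    (fun z => (z.1 ^+ (mon r).1 * z.2 ^+ (mon r).2 * peval a z)%:E) /\
  (\int[mu]_z (z.1 ^+ (mon r).1 * z.2 ^+ (mon r).2 * peval a z)%:E
    = ((M3 beta *m a) r 0)%:E)%E.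
Proof.
move=> mu_rep.
have E (z : R * R) : (z.1 ^+ (mon r).1 * z.2 ^+ (mon r).2 * peval a z)%:E =
    (\sum_(k < 10) (a k 0)%:E * (z.1 ^+ ((mon r).1 + (mon k).1)
        * z.2 ^+ ((mon r).2 + (mon k).2))%:E)%E.
  rewrite /peval mulr_sumr -sumEFin; apply: eq_bigr => k _.
  by rewrite -EFinM; congr (_%:E); rewrite !exprD; ring.
have deg (k : 'I_10) :
    ((mon r).1 + (mon k).1 + ((mon r).2 + (mon k).2) <= 6)%N.
  by rewrite addnACA (leq_add (mon_deg r) (mon_deg k)).
have int (k : 'I_10) : mu.-integrable setT (fun z : R * R =>
    ((a k 0)%:E * (z.1 ^+ ((mon r).1 + (mon k).1)
        * z.2 ^+ ((mon r).2 + (mon k).2))%:E)%E).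
  by apply: integrableZl => //; exact: (mu_rep _ _ (deg k)).1.
rewrite (funext E); split; first exact: integrable_sum.
rewrite integral_sum// mxE -sumEFin; apply: eq_bigr => k _.
have [i e] := mu_rep _ _ (deg k).
by rewrite integralZl// e -EFinM mxE mulrC.
Qed.

(** Expanding one factor of p^2 into monomials gives the integral of p^2 as the sum of a_r (M a)_r,
    which is 0. *)
Lemma ker_ae_eq0 (R : realType) (beta : nat -> nat -> R)
    (mu : {measure set (R * R) -> \bar R}) (a : 'cV[R]_10) :
  represents R mu beta -> M3 beta *m a = 0 ->
  {ae mu, forall z, peval a z = 0}.
Proof.
move=> mu_rep a0.
have : (\int[mu]_z `|(peval a z ^+ 2)%:E| = 0)%E.
  transitivity (\int[mu]_z \sum_(r < 10) ((a r 0)%:E *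
      (z.1 ^+ (mon r).1 * z.2 ^+ (mon r).2 * peval a z)%:E))%E.
    apply: eq_integral => z _; rewrite abse_EFin ger0_norm ?sqr_ge0// expr2.
    rewrite {1}/peval mulr_suml -sumEFin; apply: eq_bigr => k _.
    by rewrite -EFinM !mulrA.
  rewrite integral_sum//; last first.
    by move=> r; apply: integrableZl => //; have [] := integral_peval_mon R beta mu a r mu_rep.
  rewrite big1// => r _; have [i e] := integral_peval_mon R beta mu a r mu_rep.
  by rewrite integralZl// e a0 mxE mule0.
move/(ae_eq_integral_abs mu measurableT).
have mp := (measurable_EFinP setT (fun z => peval a z ^+ 2)).2
  (measurable_funX 2 (measurable_peval _ a)).
move=> /(_ mp); apply: filterS => z /(_ I) [] /eqP.
by rewrite sqrf_eq0 => /eqP.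
Qed.

Lemma ae_eq0_ker (R : realType) (beta : nat -> nat -> R)
    (mu : {measure set (R * R) -> \bar R}) (a : 'cV[R]_10) :
  represents R mu beta -> {ae mu, forall z, peval a z = 0} ->
  M3 beta *m a = 0.
Proof.
move=> mu_rep a0; apply/colP => r; rewrite [RHS]mxE.
have [i e] := integral_peval_mon R beta mu a r mu_rep.
apply: EFin_inj; rewrite -e -[RHS](integral0 mu setT).
apply: ae_eq_integral => //.
  apply: (measurable_EFinP setT (fun z : R * R => _ * peval a z)).2.
  apply: measurable_funM; first exact: measurable_monomial.
  exact: measurable_peval.
by apply: filterS a0 => z /= -> _; rewrite mulr0.
Qed.

(** * Relations among the columns, relative to the basis *)

Lemma B3f_inB3 i : nat_of_ord (B3f i) \in B3idx.
Proof. by rewrite /B3f inordK; case: i; do 7?[case => //]. Qed.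

(** Column k minus its expansion in the basis columns is the relation sought; [B] places
    coefficients at the basis positions. *)
Lemma B3_relation (R : fieldType) (beta : nat -> nat -> R) (k : 'I_10) :
  B3_basis beta -> nat_of_ord k \notin B3idx ->
  exists f : 'cV_10, [/\ M3 beta *m f = 0, f k 0 = 1 &
    forall j : 'I_10, nat_of_ord j \notin B3idx -> j != k -> f j 0 = 0].
Proof.
move=> [_ /andP[_ /submxP[D eD]]] kB.
pose B : 'M[R]_(10, 7) := colsub B3f 1%:M.
have MB : colsub B3f (M3 beta) = M3 beta *m B by rewrite mulmx_colsub mulmx1.
have Bw (w : 'cV_7) (j : 'I_10) : nat_of_ord j \notin B3idx ->
    (B *m w) j 0 = 0.
  move=> jB; rewrite mxE big1// => i _; rewrite !mxE.
  case: eqP => [e|]; last by rewrite mul0r.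
  by move: jB; rewrite e B3f_inB3.
have eM : M3 beta = M3 beta *m B *m D^T.
  by rewrite -MB -[LHS]trmxK eD trmx_mul trmxK.
exists (delta_mx k 0 - B *m col k D^T); split.
- by rewrite colE mulmxBr !mulmxA -eM subrr.
- by rewrite mxE [X in _ + X]mxE Bw// subr0 mxE !eqxx.
- move=> j jB jk.
  by rewrite mxE [X in _ + X]mxE Bw// subr0 mxE (negPf jk).
Qed.

Lemma B3_ker_eq0 (R : fieldType) (beta : nat -> nat -> R) (a : 'cV_10) :
  B3_basis beta -> M3 beta *m a = 0 ->
  (forall j : 'I_10, nat_of_ord j \notin B3idx -> a j 0 = 0) -> a = 0.
Proof.
move=> [free _] a0 aB.
have eM : M3 beta *m a = colsub B3f (M3 beta) *m rowsub B3f a.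
  apply/colP => i; rewrite !mxE big_ord10 !big_ord_recl big_ord0 !addr0.
  rewrite (aB (inord 6)) ?(aB (inord 7)) ?(aB (inord 9)) ?inordK //.
  rewrite !mulr0 !addr0 !addrA.
  by rewrite ![colsub _ _ _ _]mxE ![rowsub _ _ _ _]mxE.
have : (rowsub B3f a)^T *m (colsub B3f (M3 beta))^T = 0.
  by rewrite -trmx_mul -eM a0 trmx0.
move/eqP; rewrite mulmx_free_eq0 // => /eqP w0.
apply/colP => j; rewrite [RHS]mxE.
have [jB|/aB//] := boolP (nat_of_ord j \in B3idx).
have /(nthP 0%N) [i i7 ei] := jB.
have -> : j = B3f (Ordinal i7 : 'I_7) by apply/val_inj; rewrite /= inordK ?ei.
by have := congr1 (fun u : 'rV_7 => u 0 (Ordinal i7 : 'I_7)) w0; rewrite !mxE.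
Qed.

(** Normal form of the relations: the positions outside the basis are 6, 7, 9 (x^3, x^2y, y^3).
    Subtracting the matching combination from a relation leaves one supported on the basis, hence 0.
    Position 8 (xy^2) stays free and carries -a, -b, -c. *)
Lemma B3_kernel (R : fieldType) (beta : nat -> nat -> R) :
  B3_basis beta -> exists f1 f2 f3 : 'cV[R]_10,
    [/\ [/\ M3 beta *m f1 = 0, M3 beta *m f2 = 0 & M3 beta *m f3 = 0],
        [/\ cf f1 6 = 1, cf f1 7 = 0 & cf f1 9 = 0],
        [/\ cf f2 6 = 0, cf f2 7 = 1 & cf f2 9 = 0],
        [/\ cf f3 6 = 0, cf f3 7 = 0 & cf f3 9 = 1]
      & forall a : 'cV_10, M3 beta *m a = 0 ->
          a = cf a 6 *: f1 + cf a 7 *: f2 + cf a 9 *: f3].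
Proof.
move=> hB.
have inordE m n : (m < 10)%N -> (n < 10)%N ->
    (inord m == inord n :> 'I_10) = (m == n).
  by move=> mn nn; rewrite -val_eqE /= !inordK.
have [|f1 [k1 e1 z1]] := B3_relation R beta (inord 6) hB; first by rewrite inordK.
have [|f2 [k2 e2 z2]] := B3_relation R beta (inord 7) hB; first by rewrite inordK.
have [|f3 [k3 e3 z3]] := B3_relation R beta (inord 9) hB; first by rewrite inordK.
have z17 : cf f1 7 = 0 by rewrite z1 ?inordK ?inordE.
have z19 : cf f1 9 = 0 by rewrite z1 ?inordK ?inordE.
have z26 : cf f2 6 = 0 by rewrite z2 ?inordK ?inordE.
have z29 : cf f2 9 = 0 by rewrite z2 ?inordK ?inordE.
have z36 : cf f3 6 = 0 by rewrite z3 ?inordK ?inordE.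
have z37 : cf f3 7 = 0 by rewrite z3 ?inordK ?inordE.
exists f1, f2, f3; split=> // a a0.
apply/eqP; rewrite -subr_eq0; apply/eqP; apply: (B3_ker_eq0 _ _ _ hB).
  by rewrite mulmxBr !mulmxDr -!scalemxAr a0 k1 k2 k3 !scaler0 !addr0 subr0.
move=> j jB.
have : [|| j == inord 6, j == inord 7 | j == inord 9 :> 'I_10].
  rewrite -!val_eqE /= !inordK //.
  by move: jB; case: j; do 10?[case => //].
by case/or3P => /eqP ->; rewrite !mxE ?e1 ?e2 ?e3 ?z17 ?z19 ?z26 ?z29 ?z36 ?z37
  ?mulr1 ?mulr0 ?addr0 ?add0r ?subrr.
Qed.

Lemma peval_lin (R : comNzRingType) (s t u : R) (f g h : 'cV[R]_10) z :
  peval (s *: f + t *: g + u *: h) z = s * peval f z + t * peval g z + u * peval h z.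
Proof.
rewrite /peval !mulr_sumr -!big_split /=; apply: eq_bigr => k _.
by rewrite !mxE; ring.
Qed.

(** * Exclusion of the exceptional leading forms *)

(** The line has more points with natural abscissa than [s] has entries. *)
Lemma finite_variety_line (R : realType) (beta : nat -> nat -> R)
    (s : seq (R * R)) (c k : R) :
  variety beta = [set z | z \in s]%classic ->
  ~ (forall x, variety beta (x, c * x + k)).
Proof.
move=> -> h.
pose g (i : nat) : R * R := (i%:R, c * i%:R + k).
have g_inj : injective g by move=> i j [/eqP]; rewrite eqr_nat => /eqP.
have gu : uniq (map g (iota 0 (size s).+1)).
  by rewrite (map_inj_uniq g_inj) iota_uniq.
have : {subset map g (iota 0 (size s).+1) <= s}.
  by move=> z /mapP[i _ ->]; exact: h.
by move/(uniq_leq_size gu); rewrite size_map size_iota ltnn.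
Qed.

Lemma leading_relations_nondegenerate (R : realType) (beta : nat -> nat -> R)
    (s : seq (R * R)) (f1 f2 f3 : 'cV[R]_10) :
  variety beta = [set z | z \in s]%classic ->
  weakly_consistent beta ->
  [/\ M3 beta *m f1 = 0, M3 beta *m f2 = 0 & M3 beta *m f3 = 0] ->
  [/\ cf f1 6 = 1, cf f1 7 = 0 & cf f1 9 = 0] ->
  [/\ cf f2 6 = 0, cf f2 7 = 1 & cf f2 9 = 0] ->
  [/\ cf f3 6 = 0, cf f3 7 = 0 & cf f3 9 = 1] ->
  (forall a : 'cV_10, M3 beta *m a = 0 ->
     a = cf a 6 *: f1 + cf a 7 *: f2 + cf a 9 *: f3) ->
  ~ (cf f2 8 = - (cf f1 8 * cf f3 8) /\ cf f2 8 * cf f3 8 = 1).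
Proof.
move=> eV wc [k1 k2 k3] [f16 f17 f19] [f26 f27 f29] [f36 f37 f39] span [bac bc].
pose a := - cf f1 8; pose b := - cf f2 8; pose c := - cf f3 8.
have f18 : cf f1 8 = - a by rewrite opprK.
have f28 : cf f2 8 = - b by rewrite opprK.
have f38 : cf f3 8 = - c by rewrite opprK.
have {bac}bac : b = a * c by rewrite /a /b /c bac; ring.
have {bc}bc : b * c = 1 by rewrite -bc /b /c; ring.
(* [g1] and [g2] are y f1 - x f2 + a x f3 and y f2 + b x f3. Their quartic parts are (b - ac) x^2y^2
   and (1 - bc) x^2y^2, hence zero, so both are cubics. *)
pose g1 : 'cV[R]_10 := \col_k
  [:: 0; - cf f2 0 + a * cf f3 0; cf f1 0;
      - cf f2 1 + a * cf f3 1; cf f1 1 - cf f2 2 + a * cf f3 2; cf f1 2;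
      - cf f2 3 + a * cf f3 3; cf f1 3 - cf f2 4 + a * cf f3 4;
      cf f1 4 - cf f2 5 + a * cf f3 5; cf f1 5]`_k.
pose g2 : 'cV[R]_10 := \col_k
  [:: 0; b * cf f3 0; cf f2 0;
      b * cf f3 1; cf f2 1 + b * cf f3 2; cf f2 2;
      b * cf f3 3; cf f2 3 + b * cf f3 4;
      cf f2 4 + b * cf f3 5; cf f2 5]`_k.
have g1E x y : peval g1 (x, y) =
    y * peval f1 (x, y) - x * peval f2 (x, y) + a * x * peval f3 (x, y).
  rewrite !pevalE !mxE !inordK //= f16 f17 f18 f19 f26 f27 f28 f29 f36 f37 f38 f39.
  by rewrite bac; ring.
have g2E x y : peval g2 (x, y) = y * peval f2 (x, y) + b * x * peval f3 (x, y).
  rewrite !pevalE !mxE !inordK //= f26 f27 f28 f29 f36 f37 f38 f39.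
  apply/eqP; rewrite -subr_eq0; apply/eqP.
  transitivity ((b * c - 1) * x ^+ 2 * y ^+ 2); first by ring.
  by rewrite bc subrr !mul0r.
have ker_g g : (forall z, peval f1 z = 0 -> peval f2 z = 0 -> peval f3 z = 0 ->
    peval g z = 0) -> M3 beta *m g = 0.
  by move=> gz; apply: wc => z Vz; apply: gz; exact: Vz.
(* Vanishing on the variety, [g1] is a relation by weak consistency, so a constant combination of
   f1, f2, f3; likewise [g2]. Its coordinates are the constants of the lifted syzygies. *)
have /span e1 : M3 beta *m g1 = 0.
  by apply: ker_g => -[x y]; rewrite g1E => -> -> ->; ring.
have /span e2 : M3 beta *m g2 = 0.
  by apply: ker_g => -[x y]; rewrite g2E => _ -> ->; ring.
have [||k kl] := common_line R f1 f2 f3 a b c (cf g1 6) (cf g1 7) (cf g1 9)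
    (cf g2 6) (cf g2 7) (cf g2 9) bac bc
    (And4 f16 f17 f18 f19) (And4 f26 f27 f28 f29) (And4 f36 f37 f38 f39).
- move=> x y; have := g1E x y; rewrite [in LHS]e1 peval_lin => /eqP.
  by rewrite eq_sym -subr_eq0 => /eqP <-; ring.
- move=> x y; have := g2E x y; rewrite [in LHS]e2 peval_lin => /eqP.
  by rewrite eq_sym -subr_eq0 => /eqP <-; ring.
apply: (finite_variety_line R beta s c k eV) => x h /span ->.
by rewrite peval_lin; have [-> -> ->] := kl x; ring.
Qed.

(** * Vanishing of a functional one degree at a time *)

(** Here [a], [b], [c] are the xy^2 coefficients themselves, opposite in sign to those of the
    leading forms x^3 - a xy^2 and so on. The hypothesis says that [d] kills all monomial multiples
    of the leading forms in degree n. *)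
Lemma moment_degree_step (R : fieldType) (d : nat -> nat -> R) (a b c : R) n :
  (3 < n)%N ->
  (forall i j, (i + j + 3 = n)%N ->
    [/\ d i.+3 j + a * d i.+1 j.+2 = 0,
        d i.+2 j.+1 + b * d i.+1 j.+2 = 0
      & d i j.+3 + c * d i.+1 j.+2 = 0]) ->
  ~ (b = - (a * c) /\ b * c = 1) ->
  forall i j, (i + j = n)%N -> d i j = 0.
Proof.
case: n => [|[|[|[|n]]]]// _ rel nondeg.
have [A1 A2 A3] : [/\ d n.+4 0 + a * d n.+2 2 = 0,
    d n.+3 1 + b * d n.+2 2 = 0 & d n.+1 3 + c * d n.+2 2 = 0].
  by apply: rel; lia.
have [B1 B2 B3] : [/\ d n.+3 1 + a * d n.+1 3 = 0,
    d n.+2 2 + b * d n.+1 3 = 0 & d n 4 + c * d n.+1 3 = 0].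
  by apply: rel; lia.
(* The same two combinations as in the exceptional case now leave (b + ac) and (1 - bc) times this
   one entry; the factors are not both zero. *)
have e2 : d n.+2 2 = 0.
  apply/eqP; apply: contra_notT nondeg => t0.
  have E1 : (b + a * c) * d n.+2 2 = 0.
    transitivity (d n.+3 1 + b * d n.+2 2 - (d n.+3 1 + a * d n.+1 3)
      + a * (d n.+1 3 + c * d n.+2 2)); first by ring.
    by rewrite A2 A3 B1; ring.
  have E2 : (1 - b * c) * d n.+2 2 = 0.
    transitivity (d n.+2 2 + b * d n.+1 3 - b * (d n.+1 3 + c * d n.+2 2)).
      by ring.
    by rewrite A3 B2; ring.
  split; apply/eqP.
    by move/eqP: E1; rewrite mulf_eq0 (negPf t0) orbF addr_eq0.
  by move/eqP: E2; rewrite mulf_eq0 (negPf t0) orbF subr_eq0 eq_sym.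
rewrite e2 mulr0 addr0 in A1; rewrite e2 mulr0 addr0 in A2.
rewrite e2 mulr0 addr0 in A3.
(* The third relation trades a factor x for a factor y, carrying the vanishing on to higher powers
   of y. *)
have rest m : (m <= n.+2)%N -> d (n.+2 - m)%N m.+2 = 0.
  elim: m => [|m IH] mn; first by rewrite subn0.
  have [|_ _] := rel (n.+2 - m.+1)%N m; first by lia.
 have -> : (n.+2 - m.+1).+1 = (n.+2 - m)%N by lia.
  by rewrite IH ?mulr0 ?addr0 //; lia.
move=> i [|[|j]] e.
- by have -> : i = n.+4 by lia.
- by have -> : i = n.+3 by lia.
- have -> : i = (n.+2 - j)%N by lia.
  by apply: rest; lia.
Qed.

(** * Construction of the representing measure *)

Lemma eq_ker_mxrank (F : fieldType) (m p n : nat) (A : 'M[F]_(m, n))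
    (B : 'M[F]_(p, n)) :
  (forall v : 'cV_n, A *m v = 0 <-> B *m v = 0) -> \rank A = \rank B.
Proof.
move=> AB.
suff : \rank (kermx A^T) = \rank (kermx B^T).
  rewrite !mxrank_ker !mxrank_tr => e.
  by have := rank_leq_col A; have := rank_leq_col B; lia.
apply/eqmx_rank/andP; split; apply/rV_subP => u /sub_kermxP u0;
  apply/sub_kermxP; apply: trmx_inj; rewrite trmx_mul trmxK trmx0;
  apply/AB; by rewrite -[u]trmxK -[X in X *m _]trmxK -trmx_mul trmxK u0 trmx0.
Qed.

Lemma mon_surj i j : (i + j <= 3)%N -> exists r : 'I_10, mon r = (i, j).
Proof.
move=> ij.
have: (i, j) \in monlist by case: i j ij => [|[|[|[|i]]]] [|[|[|[|j]]]].
by move/(nthP (0, 0)%N) => [r r10 e]; exists (Ordinal r10).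
Qed.

Lemma weakly_consistent_rep (R : realType) (beta : nat -> nat -> R) :
  psd (M3 beta) -> \rank (M3 beta) = 7%N ->
  (exists s : seq (R * R), uniq s /\ size s = 7%N /\
     variety beta = [set z | z \in s]%classic) ->
  B3_basis beta -> weakly_consistent beta -> has_rep_measure beta.
Proof.
move=> [_ psdM] rkM [s [_ [ss eV]]] hB wc.
have [f1 [f2 [f3 [ker lf1 lf2 lf3 span]]]] := B3_kernel R beta hB.
have nondeg := leading_relations_nondegenerate R beta s f1 f2 f3 eV wc
  ker lf1 lf2 lf3 span.
pose z (k : nat) := nth (0, 0) s k.
(* Evaluation of the ten monomials at the seven points of the variety. *)
pose E : 'M[R]_(7, 10) :=
  \matrix_(k < 7, j < 10) ((z k).1 ^+ (mon j).1 * (z k).2 ^+ (mon j).2).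
have Ea (a : 'cV_10) k : (E *m a) k 0 = peval a (z k).
  by rewrite mxE; apply: eq_bigr => j _; rewrite mxE; ring.
have Vz (k : 'I_7) : variety beta (z k) by rewrite eV /= mem_nth ?ss.
have kerE (a : 'cV_10) : M3 beta *m a = 0 <-> E *m a = 0.
  split=> [a0|a0]; first by apply/colP => k; rewrite Ea mxE Vz.
  apply: wc => y; rewrite eV /= => /(nthP (0, 0)) [k ks <-].
  rewrite ss in ks.
  by rewrite -(Ea a (Ordinal ks)) a0 mxE.
(* Equal kernels give [E] rank 7, so it has a right inverse [P], whose columns are Lagrange
   interpolants. *)
have : row_free E by rewrite /row_free -(eq_ker_mxrank _ _ _ _ _ _ kerE) rkM.
move=> /row_freeP[P EP].
(* [E] kills the columns of 1 - P E, so these are relations. *)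
have MPE : M3 beta = M3 beta *m P *m E.
  apply/eqP; rewrite -subr_eq0 -mulmxA -[X in X - _]mulmx1 -mulmxBr.
  apply/eqP/matrixP => i j; rewrite [RHS]mxE.
  have /kerE : E *m col j (1%:M - P *m E) = 0.
    by rewrite colE mulmxA mulmxBr mulmx1 mulmxA EP mul1mx subrr mul0mx.
  by move/colP/(_ i); rewrite colE mulmxA -colE !mxE.
(* Row 0 belongs to the monomial 1, so this is the Riesz functional at the k-th interpolant. *)
pose w (k : nat) : R := (M3 beta *m P) 0 (inord k).
pose d (i j : nat) := beta i j - \sum_(k < 7) w k * ((z k).1 ^+ i * (z k).2 ^+ j).
have d3 i j : (i + j <= 3)%N -> d i j = 0.
  move=> ij; have [r er] := mon_surj i j ij.
  have := congr1 (fun A : 'M[R]_10 => A 0 r) MPE.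
  rewrite mxE er /= add0n add0n /d => ->; apply/eqP; rewrite subr_eq0; apply/eqP.
  rewrite mxE; apply: eq_bigr => k _; rewrite [E _ _]mxE er; congr (_ * _).
  by rewrite /w inord_val.
(* The Riesz functional contributes an entry of M a; the atomic part vanishes because the relation
   is zero at each point. *)
have dker (a : 'cV_10) i j : M3 beta *m a = 0 -> (i + j <= 3)%N ->
    \sum_(k < 10) a k 0 * d (i + (mon k).1)%N (j + (mon k).2)%N = 0.
  move=> a0 ij; have [r er] := mon_surj i j ij.
  transitivity ((M3 beta *m a) r 0 - \sum_(l < 7)
      w l * ((z l).1 ^+ i * (z l).2 ^+ j) * peval a (z l)).
    rewrite mxE; under [X in _ - X]eq_bigr do rewrite /peval mulr_sumr.
    rewrite exchange_big /= -sumrB; apply: eq_bigr => k _.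
    rewrite mxE er /= /d mulrBr mulrC; congr (_ - _).
    by rewrite mulr_sumr; apply: eq_bigr => l _; rewrite !exprD; ring.
  by rewrite a0 mxE big1 ?subr0 // => l _; rewrite (Vz l a a0) mulr0.
have dstep n : (3 < n <= 6)%N ->
    (forall i j, (i + j < n)%N -> d i j = 0) ->
    forall i j, (i + j = n)%N -> d i j = 0.
  move=> n36 low; have n3 : (3 < n)%N by lia.
  apply: (moment_degree_step _ d (cf f1 8) (cf f2 8) (cf f3 8) n n3 _ nondeg).
  move=> i j ij; have ij3 : (i + j <= 3)%N by lia.
  (* By induction on the degree, only the cubic part of the relation survives. *)
  have top (a : 'cV_10) : M3 beta *m a = 0 ->
      cf a 6 * d i.+3 j + cf a 7 * d i.+2 j.+1 + cf a 8 * d i.+1 j.+2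
        + cf a 9 * d i j.+3 = 0.
    move=> a0; rewrite -(dker a i j a0 ij3) big_ord10 !inordK // /mon /=.
    rewrite !addn0 !addn1 !addn2 !addn3.
    rewrite (low i j) ?(low i.+1 j) ?(low i j.+1) ?(low i.+2 j) ?(low i.+1 j.+1)
      ?(low i j.+2); try lia.
    by rewrite !mulr0 !add0r.
  have [k1 k2 k3] := ker; have [f16 f17 f19] := lf1.
  have [f26 f27 f29] := lf2; have [f36 f37 f39] := lf3.
  split.
  - by rewrite -[RHS](top f1 k1) f16 f17 f19; ring.
  - by rewrite -[RHS](top f2 k2) f26 f27 f29; ring.
  - by rewrite -[RHS](top f3 k3) f36 f37 f39; ring.
have d0 n i j : (i + j <= n)%N -> (n <= 6)%N -> d i j = 0.
  elim: n i j => [|n IH] i j ij n6; first by apply: d3; lia.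
  have [lt|ge] := leqP (i + j) n; first by apply: IH => //; lia.
  have [small|big] := leqP (i + j) 3; first exact: d3.
  apply: (dstep n.+1); [lia| |lia].
  by move=> i' j' lt; apply: IH; lia.
have betaE i j : (i + j <= 6)%N ->
    beta i j = \sum_(k < 7) w k * ((z k).1 ^+ i * (z k).2 ^+ j).
  by move=> ij; apply/eqP; rewrite -subr_eq0; apply/eqP/(d0 6%N).
have ME : M3 beta = E^T *m diag_mx (\row_k w k) *m E.
  apply/matrixP => i j; rewrite mxE betaE; last first.
    by rewrite addnACA (leq_add (mon_deg i) (mon_deg j)).
  rewrite mxE; apply: eq_bigr => k _.
  by rewrite mul_mx_diag !mxE !exprD; ring.
(* Positive semidefiniteness is tested on the k-th interpolant: since E P = 1, the quadratic form
   there equals w k. *)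
have w0 (k : 'I_7) : 0 <= w k.
  have := psdM (P *m delta_mx k 0).
  rewrite ME trmx_mul.
  have -> : (delta_mx k 0)^T *m P^T *m (E^T *m diag_mx (\row_k w k) *m E)
      *m (P *m delta_mx k 0) = (delta_mx k 0)^T *m (E *m P)^T
      *m diag_mx (\row_k w k) *m (E *m P *m delta_mx k 0) :> 'M[R]_1.
    by rewrite trmx_mul !mulmxA.
  by rewrite EP trmx1 mulmx1 mul1mx -mulmxA -colE trmx_delta -rowE !mxE eqxx.
have w0' k : 0 <= w (inord k : 'I_7) by exact: w0.
have [mu hmu] := atomic_measure R _ (R * R)%type 7 _ (fun k => z k) w0'.
exists mu => i j ij.
have [int e] := hmu _ (measurable_monomial R i j).
split; first exact: int.
rewrite e betaE //; congr (_%:E); apply: eq_bigr => k _.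
by rewrite inord_val.
Qed.

(** * Necessity of weak consistency, and the equivalence *)

(** Almost every point is a common zero of f1, f2, f3, which span the relations, and so lies in the
    variety. *)
Lemma rep_weakly_consistent (R : realType) (beta : nat -> nat -> R) :
  B3_basis beta -> has_rep_measure beta -> weakly_consistent beta.
Proof.
move=> hB [mu rep] a aV.
have [f1 [f2 [f3 [[k1 k2 k3] _ _ _ span]]]] := B3_kernel R beta hB.
apply: (ae_eq0_ker R beta mu a rep).
have := ker_ae_eq0 R beta mu f1 rep k1.
have := ker_ae_eq0 R beta mu f2 rep k2.
have := ker_ae_eq0 R beta mu f3 rep k3.
apply: filterS3 => z e3 e2 e1; apply: aV => b /span ->.
by rewrite peval_lin e1 e2 e3; ring.
Qed.

Theorem theorem4p4 (R : realType) (beta : nat -> nat -> R) :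
  psd (M3 beta) ->
  pd (M2 beta) ->
  \rank (M3 beta) = 7%N ->
  (exists s : seq (R * R), uniq s /\ size s = 7%N /\
     variety beta = [set z | z \in s]%classic) ->
  B3_basis beta ->
  (has_rep_measure beta <-> weakly_consistent beta).
Proof.
move=> psdM _ rkM Vs hB; split; first exact: rep_weakly_consistent.
exact: weakly_consistent_rep.
Qed.
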